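(* Let $m\in\mathbb{Z}_{>0}$ and $n\in\mathbb{Z}_{\ge0}$ have the same parity, and let $\psi:\mathcal{G}^{(m,n)}\to\mathbb{C}$ be a Whittaker function. Then the Whittaker module $W_{\psi}=\mathrm{Ind}_{\mathcal{G}^{(m,n)}}^{\mathcal{G}}\mathbb{C}w_\psi=\mathcal{U}(\mathcal{G})\otimes_{\mathcal{U}(\mathcal{G}^{(m,n)})}\mathbb{C}w_\psi$ is an irreducible $\mathcal{G}$-module if and only if $\psi(I_{m+n-1})\,\psi(J_{m+n-1})\ne0$.
   Context: $\mathcal{G}$ is the complex Lie algebra with basis $\{L_n,H_n,I_n,J_n,\mathbf{c}_1,\mathbf{c}_2,\mathbf{c}_3: n\in\mathbb{Z}\}$ whose brackets of basis elements are $[L_m,L_n]=(n-m)L_{m+n}+\frac{m^3-m}{12}\delta_{m+n,0}\mathbf{c}_1$, $[L_m,H_n]=nH_{m+n}+m^2\delta_{m+n,0}\mathbf{c}_2$, $[H_m,H_n]=m\delta_{m+n,0}\mathbf{c}_3$, $[L_m,I_n]=(n-m)I_{m+n}$, $[L_m,J_n]=(n-m)J_{m+n}$, $[H_m,I_n]=I_{m+n}$, $[H_m,J_n]=-J_{m+n}$ (and antisymmetric counterparts), all other brackets of basis elements zero (this is the universal central extension of the planar Galilean conformal algebra). For $m,n\ge0$, $\mathcal{G}^{(m,n)}=\sum_{i\ge0}(\mathbb{C}L_{m+i}+\mathbb{C}H_{m+i}+\mathbb{C}I_{n+i}+\mathbb{C}J_{n+i})+\sum_{k=1}^3\mathbb{C}\mathbf{c}_k$.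 A Whittaker function is a Lie algebra homomorphism $\psi:\mathcal{G}^{(m,n)}\to\mathbb{C}$, and $\mathbb{C}w_\psi$ is the one-dimensional $\mathcal{G}^{(m,n)}$-module with $xw_\psi=\psi(x)w_\psi$. *)

(* Defs.v *)
From HB Require Import structures.
From mathcomp Require Import all_boot all_order all_algebra.
From mathcomp Require Import complex.
From mathcomp Require Import reals.
Set Implicit Arguments. Unset Strict Implicit. Unset Printing Implicit Defensive.
Import Order.TTheory GRing.Theory Num.Theory.
Local Open Scope ring_scope.

Notation Cx R := (complex (Real.sort R)).

(* Basis of the (centrally extended) planar Galilean conformal algebra G:
   L_n, H_n, I_n, J_n (n in Z) and the central elements c1, c2, c3. *)
Inductive Gen := gL of int | gH of int | gI of int | gJ of int | gc1 | gc2 | gc3.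

Section Bracket.
Variable R : realType.
Local Notation C := (Cx R).

Definition delta0 (i : int) (s : seq (C * Gen)) : seq (C * Gen) :=
  if i == 0 then s else [::].

(* [a, b] for basis elements a, b, as a finite linear combination of basis
   elements (list of (coefficient, basis element)). *)
Definition br (a b : Gen) : seq (C * Gen) :=
  match a, b with
  | gL i, gL j => ((j - i)%:~R, gL (i + j))
                   :: delta0 (i + j) [:: ((i ^+ 3 - i)%:~R / 12%:R, gc1)]
  | gL i, gH j => (j%:~R, gH (i + j)) :: delta0 (i + j) [:: ((i ^+ 2)%:~R, gc2)]
  | gH i, gL j => (- i%:~R, gH (i + j)) :: delta0 (i + j) [:: (- (j ^+ 2)%:~R, gc2)]
  | gH i, gH j => delta0 (i + j) [:: (i%:~R, gc3)]
  | gL i, gI j => [:: ((j - i)%:~R, gI (i + j))]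
  | gI j, gL i => [:: ((i - j)%:~R, gI (i + j))]
  | gL i, gJ j => [:: ((j - i)%:~R, gJ (i + j))]
  | gJ j, gL i => [:: ((i - j)%:~R, gJ (i + j))]
  | gH i, gI j => [:: (1, gI (i + j))]
  | gI j, gH i => [:: (-1, gI (i + j))]
  | gH i, gJ j => [:: (-1, gJ (i + j))]
  | gJ j, gH i => [:: (1, gJ (i + j))]
  | _, _ => [::]
  end.

Definition inSub (m n : nat) (b : Gen) : bool :=
  match b with
  | gL i | gH i => (m%:Z <= i)%R
  | gI i | gJ i => (n%:Z <= i)%R
  | _ => true
  end.

Definition lin (psi : Gen -> C) (s : seq (C * Gen)) : C :=
  \sum_(p <- s) p.1 * psi p.2.

(* Whittaker function: a Lie algebra homomorphism G^(m,n) -> C, given by its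
   values on the basis of G^(m,n) (values on other basis elements irrelevant):
   it must vanish on all brackets [a,b] of basis elements a,b of G^(m,n). *)
Definition whittaker_fun (m n : nat) (psi : Gen -> C) : Prop :=
  forall a b, inSub m n a -> inSub m n b -> lin psi (br a b) = 0.

Section Modules.
Variable V : lmodType C.

Definition actv (rho : Gen -> {linear V -> V}) (s : seq (C * Gen)) (v : V) : V :=
  \sum_(p <- s) p.1 *: rho p.2 v.

Definition is_rep (rho : Gen -> {linear V -> V}) : Prop :=
  forall a b v, rho a (rho b v) - rho b (rho a v) = actv rho (br a b) v.

Definition whittaker_vec (m n : nat) (psi : Gen -> C)
  (rho : Gen -> {linear V -> V}) (w : V) : Prop :=
  forall b, inSub m n b -> rho b w = psi b *: w.

Definition submodule (rho : Gen -> {linear V -> V}) (U : V -> Prop) : Prop :=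
  [/\ U 0, (forall (a : C) u v, U u -> U v -> U (a *: u + v))
    & (forall b u, U u -> U (rho b u))].

Definition irreducible (rho : Gen -> {linear V -> V}) : Prop :=
  (exists v : V, v != 0) /\
  forall U, submodule rho U -> (forall v, U v -> v = 0) \/ (forall v, U v).
End Modules.

Definition intertwines (V W : lmodType C) (rho : Gen -> {linear V -> V})
  (sigma : Gen -> {linear W -> W}) (f : {linear V -> W}) : Prop :=
  forall b v, f (rho b v) = sigma b (f v).

(* (W, rho, w) is the induced module Ind_{G^(m,n)}^G C w_psi, characterised by
   its universal property: a G-module generated freely by a Whittaker vector w
   of type psi, i.e. for every G-module V and every v in V with x v = psi(x) v
   (x in G^(m,n)) there is a unique G-module map W -> V sending w to v. *)
Definition induced_whittaker (m n : nat) (psi : Gen -> C) (W : lmodType C)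
  (rho : Gen -> {linear W -> W}) (w : W) : Prop :=
  [/\ is_rep rho, whittaker_vec m n psi rho w &
   forall (V : lmodType C) (sigma : Gen -> {linear V -> V}) (v : V),
     is_rep sigma -> whittaker_vec m n psi sigma v ->
     (exists f : {linear W -> V}, intertwines rho sigma f /\ f w = v) /\
     (forall f g : {linear W -> V},
        intertwines rho sigma f -> f w = v ->
        intertwines rho sigma g -> g w = v -> f =1 g)].
End Bracket.

(* Main.v *)
Require Import Defs.
From HB Require Import structures.
From mathcomp Require Import all_boot all_order all_algebra.
From mathcomp Require Import complex.
From mathcomp Require Import reals boolp.
From mathcomp Require Import ring zify.
From mathcomp.multinomials Require Import freeg.
Import Order.TTheory GRing.Theory Num.Theory.
Local Open Scope ring_scope.

(* Put N = m + n - 1.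

   If psi(I_N) = 0, then I_{n-1} can be added to the subalgebra with an
   arbitrary eigenvalue t. By the Poincare-Birkhoff-Witt theorem these enlarged
   characters come from nonzero modules; the kernel of the map from W to the
   module for t = 0 is proper and contains I_{n-1} w, which is nonzero because
   it survives for t = 1. The case psi(J_N) = 0 is identical.

   If a = psi(I_N) and b = psi(J_N) are both nonzero, let U be a submodule
   avoiding w. W is spanned by words in L_i, H_i (i < m) applied to words in
   I_j, J_j (j < n) applied to w. Combinations of I_{N-i} - psi(I_{N-i}) and
   J_{N-i} - psi(J_{N-i}) act, modulo words of lower degree, as the partial
   derivatives with respect to L_i and H_i on words whose letters all have
   index at least i; the relevant determinant is a multiple of a b (N - 2i),
   and N is odd. Similarly L_{N-j}, H_{N-j} differentiate with respect to I_j
   and J_j. Hence elements of U lose degree until they are multiples of w, that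
   is, zero. *)
Set Implicit Arguments. Unset Strict Implicit. Unset Printing Implicit Defensive.

(** * Linear spans *)

Section Span.
Variables (K : pzRingType) (V : lmodType K).

Definition subspace (U : V -> Prop) :=
  U 0 /\ forall a u v, U u -> U v -> U (a *: u + v).

(** Combinations grow by one term at a time, so that claims about spans are proved by induction,
    without bases or finite supports. *)
Inductive lspan (B : V -> Prop) : V -> Prop :=
| lspan0 : lspan B 0
| lspan_lin a u v : B u -> lspan B v -> lspan B (a *: u + v).

Section Closure.
Variables (U : V -> Prop) (sU : subspace U).

Lemma sub0 : U 0. Proof. exact: sU.1. Qed.

Lemma subD u v : U u -> U v -> U (u + v).
Proof. by move=> Uu Uv; have := sU.2 1 u v Uu Uv; rewrite scale1r. Qed.

Lemma subZ a u : U u -> U (a *: u).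
Proof. by move=> Uu; have := sU.2 a u 0 Uu sub0; rewrite addr0. Qed.

Lemma subN u : U u -> U (- u).
Proof. by move=> Uu; rewrite -scaleN1r; apply: subZ. Qed.

Lemma subB u v : U u -> U v -> U (u - v).
Proof. by move=> Uu Uv; apply: subD => //; apply: subN. Qed.

Lemma sub_sum (I : eqType) (r : seq I) (F : I -> V) :
  (forall i, i \in r -> U (F i)) -> U (\sum_(i <- r) F i).
Proof.
elim: r => [|i r IH] UF; first by rewrite big_nil; exact: sub0.
rewrite big_cons; apply: subD; first by apply: UF; rewrite inE eqxx.
by apply: IH => j jr; apply: UF; rewrite inE jr orbT.
Qed.

Lemma lspan_sub (B : V -> Prop) v : (forall u, B u -> U u) -> lspan B v -> U v.
Proof.
move=> BU; elim=> [|a u t Bu _ Ut]; first exact: sub0.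
by apply: sU.2 => //; apply: BU.
Qed.

End Closure.

Lemma lspan_subspace B : subspace (lspan B).
Proof.
split=> [|a u v]; first exact: lspan0.
elim=> [|b t u' Bt _ IH] Sv; first by rewrite scaler0 add0r.
by rewrite scalerDr scalerA -addrA; apply: lspan_lin => //; apply: IH.
Qed.

Lemma lspan_base (B : V -> Prop) u : B u -> lspan B u.
Proof.
by move=> Bu; have := lspan_lin 1 Bu (lspan0 B); rewrite scale1r addr0.
Qed.

Lemma lspan_mono (B B' : V -> Prop) v :
  (forall u, B u -> lspan B' u) -> lspan B v -> lspan B' v.
Proof. by move=> BB'; apply: lspan_sub => //; apply: lspan_subspace. Qed.

End Span.

Lemma lspan_preim (K : pzRingType) (V W : lmodType K) (f : V -> W)
  (B : V -> Prop) (U : W -> Prop) v : subspace U -> linear f ->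
  (forall u, B u -> U (f u)) -> lspan B v -> U (f v).
Proof.
move=> sU lf; apply: (@lspan_sub _ _ (fun v => U (f v))).
split=> [|a u t Uu Ut]; last by rewrite lf; apply: sU.2.
have := lf (-1) 0 0; rewrite scaler0 addr0 scaleN1r addNr => ->; exact: sub0.
Qed.

(** * Filtrations lowered by approximate partial derivatives *)

Section Contract.
Variables (K : numFieldType) (W : lmodType K) (T : eqType).
Variables (r : T -> {linear W -> W}) (X : pred T) (base : W -> Prop).

Definition word s b := foldr (fun x v => r x v) b s.

(** The strict bound makes [filt 0] the zero space, so lowering the degree of a base vector yields
    zero with no special case. *)
Definition filt d := lspan (fun v => exists s b,
  [/\ all X s, (size s < d)%N, base b & v = word s b]).

Lemma filt_subspace d : subspace (filt d).
Proof. exact: lspan_subspace. Qed.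

Lemma filt_word d s b : all X s -> (size s < d)%N -> base b -> filt d (word s b).
Proof. by move=> Xs sd Bb; apply: lspan_base; exists s, b. Qed.

Lemma filt0 v : filt 0 v -> v = 0.
Proof.
move=> Fv; apply: (@lspan_sub _ _ (fun v => v = 0) _ _ _ _ Fv).
  by split=> // a u t -> ->; rewrite scaler0 addr0.
by move=> u [s] [b] [].
Qed.

Lemma filtW d e v : (d <= e)%N -> filt d v -> filt e v.
Proof.
move=> de; apply: lspan_mono => _ [s [b [Xs sd Bb ->]]].
by apply: filt_word => //; apply: leq_trans de.
Qed.

Lemma filt_letter d x v : X x -> filt d v -> filt d.+1 (r x v).
Proof.
move=> Xx; apply: (lspan_preim (f := r x) (filt_subspace _)).
  exact: linearP.
move=> _ [s [b [Xs sd Bb ->]]].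
by rewrite -[r x _]/(word (x :: s) b); apply: filt_word => //=; rewrite Xx.
Qed.

Lemma word_lspan_mono (P Q : seq T -> Prop) v : (forall s, P s -> Q s) ->
  lspan (fun v => exists s b, [/\ P s, base b & v = word s b]) v ->
  lspan (fun v => exists s b, [/\ Q s, base b & v = word s b]) v.
Proof.
move=> PQ; apply: lspan_mono => _ [s [b [Ps Bb ->]]].
by apply: lspan_base; exists s, b; split=> //; apply: PQ.
Qed.

Variables (A : T -> {linear W -> W}) (idx : T -> int).

Let le_idx x y := idx x <= idx y.

(** Only finitely many letters occur in a given vector. Sorting them by index allows the least one
    to be removed first, when the derivative rule holds against all the letters that remain. *)
Lemma filt_letters d u : filt d u -> exists S, [/\ all X S, sorted le_idx S &
  lspan (fun v => exists s b, [/\ (size s < d)%N /\ {subset s <= S}, base b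
                                & v = word s b]) u].
Proof.
move=> Fu; suff [S [XS Su]] : exists S, all X S /\
    lspan (fun v => exists s b, [/\ (size s < d)%N /\ {subset s <= S}, base b
                                  & v = word s b]) u.
  exists (sort le_idx S); split; first by rewrite all_sort.
    by apply: sort_sorted => x y; apply: le_total.
  apply: word_lspan_mono Su => s [sd sS]; split=> // y /sS.
  by rewrite mem_sort.
elim: Fu => [|a _ v [s [b [Xs sd Bb ->]]] _ [S [XS Sv]]].
  by exists [::]; split=> //; apply: lspan0.
exists (s ++ S); rewrite all_cat Xs XS; split=> //.
apply: (lspan_subspace _).2; last first.
  apply: word_lspan_mono Sv => t [td tS]; split=> // y /tS.
  by rewrite mem_cat orbC => ->.
by apply: lspan_base; exists s, b; split=> //; split=> // y; rewrite mem_cat => ->.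
Qed.

(* The Euler operator [r x A x] counts the occurrences of [x] modulo [Low], so
   on its kernel the words containing [x] can be discarded one count at a time;
   no linear independence of the words is needed. *)
Lemma drop_letter (Low : W -> Prop) (P : seq T -> Prop) x S u :
  subspace Low -> (forall v, Low v -> Low (r x (A x v))) ->
  (forall s b, P s -> {subset s <= x :: S} -> base b ->
    Low (r x (A x (word s b)) - (count_mem x s)%:R *: word s b)) ->
  A x u = 0 ->
  lspan (fun v => Low v \/ exists s b, [/\ P s, {subset s <= x :: S},
     base b & v = word s b]) u ->
  lspan (fun v => Low v \/ exists s b, [/\ P s, {subset s <= S},
     base b & v = word s b]) u.
Proof.
move=> sL xAL euler Au Su.
pose Q c := lspan (fun v => Low v \/ exists s b, [/\ P s,
   {subset s <= x :: S}, base b & (count_mem x s <= c)%N /\ v = word s b]).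
have sQ c : subspace (Q c) by apply: lspan_subspace.
have QL c v : Low v -> Q c v by move=> ?; apply: lspan_base; left.
(* Modulo [Low], the Euler operator minus [c.+1] kills the words with exactly [c.+1] occurrences of
   [x] and rescales the others. As [A x u = 0], its value at [u] is [- c.+1%:R *: u], and [c.+1] is
   invertible in characteristic zero. *)
have step c : Q c.+1 u -> Q c u.
  move=> Qu; have : Q c (r x (A x u) - c.+1%:R *: u).
    apply: (lspan_preim (f := fun u => r x (A x u) - c.+1%:R *: u) (sQ c) _ _ Qu).
      move=> a v v'; rewrite (linearP (A x)) (linearP (r x)) /=.
      by rewrite scalerDr scalerBr !scalerA [in _ * a]mulrC addrACA opprD.
    move=> v [Lv|[s [b [Ps sxS Bb [cs ->]]]]].
      by apply: QL; apply: (subB sL); [apply: xAL | apply: subZ].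
    have /(QL c) Qe := euler s b Ps sxS Bb.
    rewrite -[r x _](subrK ((count_mem x s)%:R *: word s b)) -addrA -scalerBl.
    apply: subD (sQ c) _ _ Qe _.
    move: cs; rewrite leq_eqVlt ltnS => /orP[/eqP->|cs].
      by rewrite subrr scale0r; apply: sub0.
    by apply: subZ => //; apply: lspan_base; right; exists s, b.
  rewrite Au linear0 sub0r => /(subN (sQ c)); rewrite opprK.
  move=> /(subZ (sQ c) (c.+1%:R)^-1).
  by rewrite scalerA mulVf ?scale1r // pnatr_eq0.
have [c Qc] : exists c, Q c u.
  elim: Su => [|a v v' Bv _ [c Qv']]; first by exists 0%N; apply: lspan0.
  have Qmono c' t : (c <= c')%N -> Q c t -> Q c' t.
    move=> cc'; apply: lspan_mono => y [Ly|[s [b [Ps sxS Bb [cs ->]]]]].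
      exact: QL.
    apply: lspan_base; right; exists s, b; split=> //; split=> //.
    exact: leq_trans cc'.
  case: Bv => [Lv|[s [b [Ps sxS Bb ->]]]].
    by exists c; apply: (sQ c).2 => //; apply: QL.
  exists (maxn c (count_mem x s)); apply: (sQ _).2; last first.
    by apply: Qmono Qv'; apply: leq_maxl.
  apply: lspan_base; right; exists s, b; split=> //; split=> //.
  exact: leq_maxr.
have : Q 0%N u by elim: (c) Qc => // c' IH /step.
apply: lspan_mono => v [Lv|[s [b [Ps sxS Bb [cs ->]]]]]; apply: lspan_base.
  by left.
right; exists s, b; split=> // y ys.
have := sxS y ys; rewrite inE => /orP[/eqP yx|//].
by move: cs; rewrite leqn0 -yx => /eqP/count_memPn; rewrite ys.
Qed.

Lemma all_subset (P : pred T) (s S : seq T) : {subset s <= S} -> all P S -> all P s.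
Proof. by move=> sS /allP PS; apply/allP => y /sS /PS. Qed.

(** * Derivatives that hold modulo lower degree *)

Section Filtered.

Hypothesis commX : forall d x y v, X x -> X y -> filt d v ->
  filt d.+1 (r x (r y v) - r y (r x v)).
Hypothesis lowerA : forall d x v, X x -> filt d.+1 v -> filt d (A x v).
Hypothesis derA : forall d x y v, X x -> X y -> idx x <= idx y -> filt d.+1 v ->
  filt d (A x (r y v) - r y (A x v) - (x == y)%:R *: v).

(** Moving [A x] past a first letter [y] produces an extra [r x] exactly when [y = x]. Swapping
    [r x] with [r y] is harmless because [A x] has already lowered the degree of what they act
    on. *)
Lemma euler_word x s b : X x -> all X s -> all (le_idx x) s ->
  base b -> filt (size s) (r x (A x (word s b)) - (count_mem x s)%:R *: word s b).
Proof.
move=> Xx; elim: s => [|y s IH] /=.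
  move=> _ _ Bb; rewrite scale0r subr0.
  have : filt 1 b by apply: (@filt_word 1 [::]).
  by move/(lowerA Xx)/filt0 => ->; rewrite linear0; apply: lspan0.
move=> /andP[Xy Xs] /andP[xy xs] Bb; have {IH} := IH Xs xs Bb.
set v := word s b; set d := size s => IH.
have Fv : filt d.+1 v by apply: filt_word.
have h1 := filt_letter Xx (derA Xx Xy xy Fv).
have h2 := commX Xx Xy (lowerA Xx Fv).
have h3 := filt_letter Xy IH.
have := subD (filt_subspace _) (subD (filt_subspace _) h1 h2) h3.
congr (filt _ _); rewrite !linearB !linearZ /= natrD scalerDl !scalerN.
have -> : (x == y)%:R *: r x v = (x == y)%:R *: r y v.
  by case: eqVneq => [->|]; rewrite ?scale0r.
by rewrite (eq_sym y) (addrAC (r x (A x _))) !addrA !subrK.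
Qed.

(** The letters are removed from the top-degree words in increasing order of index. When none is
    left, no word of positive length remains and only lower degree survives. *)
Lemma filt_drop d u : filt d.+2 u -> (forall x, X x -> A x u = 0) -> filt d.+1 u.
Proof.
move=> /filt_letters[S [XS sS Su]] Au.
pose top (S' : seq T) := lspan (fun v => filt d.+1 v \/ exists s b,
  [/\ size s = d.+1, {subset s <= S'}, base b & v = word s b]).
have {Su} : top S u.
  apply: lspan_mono Su => _ [s [b [[sd sS'] Bb ->]]]; apply: lspan_base.
  move: sd; rewrite ltnS leq_eqVlt => /orP[/eqP sd|sd]; first by right; exists s, b.
  by left; apply: filt_word => //; apply: all_subset XS.
elim: S XS sS => [_ _ Tu|x S IH /andP[Xx XS] sS Tu].
  apply: lspan_mono Tu => t [//|[[|y s] [b [sd sS Bb _]]]] //.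
  by have := sS y (mem_head _ _).
have le_tr : transitive le_idx by move=> x1 x2 x3; apply: le_trans.
have xS := order_path_min le_tr sS.
apply: IH => //; first exact: path_sorted sS.
apply: (drop_letter (Low := filt d.+1) _ _ _ (Au x Xx) Tu).
- exact: filt_subspace.
- by move=> v Fv; apply: filt_letter => //; apply: lowerA.
- move=> s b <- sxS Bb; apply: euler_word => //.
    by apply: all_subset sxS _; rewrite /= Xx.
  by apply: all_subset sxS _; rewrite /= xS andbT; apply: lexx.
Qed.

(** Induction on the degree, with the hypothesis used twice: it kills all derivatives of [v], whence
    [filt_drop] lowers the degree of [v], and then it kills [v] itself. *)
Lemma filt_trivial U : (forall x v, X x -> U v -> U (A x v)) ->
  (forall v, U v -> filt 1 v -> v = 0) -> forall d v, U v -> filt d v -> v = 0.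
Proof.
move=> UA U1; elim=> [|[|d] IH] v Uv; [by move/filt0|exact: U1|].
move=> Fv; apply: (IH) => //; apply: filt_drop => // x Xx.
by apply: IH; [apply: UA | apply: lowerA].
Qed.

End Filtered.

(** * Exact derivatives on words in commuting letters *)

Section Exact.

Hypothesis commX : forall x y v, X x -> X y -> r x (r y v) = r y (r x v).
Hypothesis A_base : forall x b, X x -> base b -> A x b = 0.
Hypothesis derA : forall d x y v, X x -> X y -> idx x <= idx y -> filt d v ->
  A x (r y v) = r y (A x v) + (x == y)%:R *: v.

Lemma euler_word_exact x s b : X x -> all X s -> all (le_idx x) s -> base b ->
  r x (A x (word s b)) = (count_mem x s)%:R *: word s b.
Proof.
move=> Xx; elim: s => [|y s IH] /=.
  by move=> _ _ Bb; rewrite scale0r A_base ?linear0.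
move=> /andP[Xy Xs] /andP[xy xs] Bb.
rewrite (derA (d := (size s).+1)) //; last exact: filt_word.
rewrite linearD linearZ /= commX // IH // linearZ /= natrD scalerDl addrC.
by rewrite (eq_sym y); case: eqVneq => [->|]; rewrite ?scale0r.
Qed.

Lemma lower_exact x s b : X x -> all X s -> all (le_idx x) s -> base b ->
  filt (size s) (A x (word s b)).
Proof.
move=> Xx; elim: s => [|y s IH] /=.
  by move=> _ _ Bb; rewrite A_base //; apply: lspan0.
move=> /andP[Xy Xs] /andP[xy xs] Bb.
rewrite (derA (d := (size s).+1)) //; last exact: filt_word.
apply: (subD (filt_subspace _)).
  by apply: filt_letter => //; apply: IH.
by apply: subZ (filt_subspace _) _ _ _; apply: filt_word.
Qed.

Lemma filt_trivial_exact U : (forall x v, X x -> U v -> U (A x v)) ->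
  (forall v, U v -> filt 1 v -> v = 0) -> forall d v, U v -> filt d v -> v = 0.
Proof.
move=> UA U1; elim=> [|[|d] IH] u Uu; [by move/filt0|exact: U1|].
move=> /filt_letters[S [XS sS Su]].
elim: S XS sS Su => [_ _ Su|x S IHS /andP[Xx XS] sS Su].
  apply: U1 => //; apply: lspan_mono Su => _ [[|y s] [b [[_ sS] Bb ->]]].
    exact: (@filt_word 1 [::]).
  by have := sS y (mem_head _ _).
have le_tr : transitive le_idx by move=> x1 x2 x3; apply: le_trans.
have xS := order_path_min le_tr sS.
have XxS (s : seq T) : {subset s <= x :: S} -> all X s.
  by move=> sxS; apply: all_subset sxS _; rewrite /= Xx.
have xxS (s : seq T) : {subset s <= x :: S} -> all (le_idx x) s.
  by move=> sxS; apply: all_subset sxS _; rewrite /= xS andbT; apply: lexx.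
have Au : A x u = 0.
  apply: IH; first exact: UA.
  apply: (lspan_preim (f := A x) (filt_subspace _) _ _ Su).
    exact: linearP.
  move=> _ [s [b [[sd sxS] Bb ->]]].
  by apply: filtW (lower_exact Xx (XxS s sxS) (xxS s sxS) Bb).
apply: IHS => //; first exact: path_sorted sS.
have Tu : lspan (fun v => v = 0 \/ exists s b, [/\ (size s < d.+2)%N,
    {subset s <= x :: S}, base b & v = word s b]) u.
  apply: lspan_mono Su => _ [s [b [[sd sxS] Bb ->]]].
  by apply: lspan_base; right; exists s, b.
have : lspan (fun v => v = 0 \/ exists s b, [/\ (size s < d.+2)%N,
    {subset s <= S}, base b & v = word s b]) u.
  apply: (drop_letter (Low := fun v => v = 0) _ _ _ Au Tu).
  - by split=> // a v v' -> ->; rewrite scaler0 addr0.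
  - by move=> v ->; rewrite !linear0.
  - by move=> s b _ sxS Bb; rewrite euler_word_exact ?subrr ?XxS ?xxS.
apply: lspan_mono => _ [->|[s [b [sd sS' Bb ->]]]]; first exact: lspan0.
by apply: lspan_base; exists s, b.
Qed.

End Exact.

End Contract.

(** * A Poincare-Birkhoff-Witt model of induced modules *)

(** Countability of [Gen] lets its words index a free module, and also provides a total order on the
    generators. *)
Definition gen_code (g : Gen) : nat * int :=
  match g with
  | gL i => (0, i) | gH i => (1, i) | gI i => (2, i) | gJ i => (3, i)
  | gc1 => (4, 0%Z) | gc2 => (5, 0%Z) | gc3 => (6, 0%Z)
  end%N.

Definition gen_decode (c : nat * int) : Gen :=
  match c with
  | (0, i) => gL i | (1, i) => gH i | (2, i) => gI i | (3, i) => gJ i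
  | (4, _) => gc1 | (5, _) => gc2 | _ => gc3
  end%N.

Lemma gen_codeK : cancel gen_code gen_decode.
Proof. by case. Qed.

HB.instance Definition _ := Countable.copy Gen (can_type gen_codeK).

(** * Antisymmetry and the Jacobi identity *)

Section LieAxioms.
Variable R : realType.
Local Notation C := (Cx R).

Lemma lin_nil (f : Gen -> C) : lin f [::] = 0.
Proof. exact: big_nil. Qed.

Lemma lin_cons (f : Gen -> C) p s : lin f (p :: s) = p.1 * f p.2 + lin f s.
Proof. exact: big_cons. Qed.

Lemma lin_delta0 (f : Gen -> C) i s : lin f (delta0 i s) = (i == 0)%:R * lin f s.
Proof. by rewrite /delta0; case: eqP; rewrite ?mul1r // mul0r lin_nil. Qed.

(** Brackets are formal lists, so the Lie axioms are stated after evaluation at an arbitrary [f]. *)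
Lemma br_anti (f : Gen -> C) x y : lin f (br R x y) = - lin f (br R y x).
Proof.
case: x => [i|i|i|i|||]; case: y => [j|j|j|j|||] /=;
  rewrite ?lin_cons ?lin_delta0 ?lin_cons ?lin_nil /= ?oppr0 ?(addrC j i) //;
  try ring.
(* What remains involves central terms, present only when [i + j = 0]; then [i] is replaced by
   [- j]. *)
all: have [/eqP|_] := eqVneq (i + j) 0; last by rewrite ?mul0r; ring.
all: by rewrite addr_eq0 => /eqP->; rewrite ?mul1r; field.
Qed.

(** [ring] treats [f (gL _)] and the like as atoms, so every arrangement of the three indices is
    first brought to the same form. *)
Let sum3E (i j k : int) (s := (i + j + k)%R) :
  ((i + (j + k))%R = s) *
  ((i + (k + j))%R = s) *
  ((j + (i + k))%R = s) *
  ((j + (k + i))%R = s) *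
  ((k + (i + j))%R = s) *
  ((k + (j + i))%R = s) *
  ((i + k + j)%R = s) *
  ((j + i + k)%R = s) *
  ((j + k + i)%R = s) *
  ((k + i + j)%R = s) *
  ((k + j + i)%R = s).
Proof. by rewrite /s; do !split; ring. Qed.

Lemma br_jacobi (f : Gen -> C) x y z :
  lin (fun g => lin f (br R x g)) (br R y z)
  - lin (fun g => lin f (br R y g)) (br R x z)
  = lin (fun g => lin f (br R g z)) (br R x y).
Proof.
case: x => [i|i|i|i|||]; case: y => [j|j|j|j|||]; case: z => [k|k|k|k|||] /=;
  rewrite ?lin_cons ?lin_delta0 ?lin_cons ?lin_nil /=
    ?lin_cons ?lin_delta0 ?lin_cons ?lin_nil /=
    ?mulr0 ?addr0 ?subr0 ?sub0r ?oppr0 // ?(sum3E i j k) //; try ring.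
all: have [/eqP|_] := eqVneq (i + j + k) 0; last by rewrite ?mul0r; ring.
all: by rewrite addrC addr_eq0 => /eqP->; rewrite ?mul1r; field.
Qed.

End LieAxioms.

(** * Linear extension from a free module *)

Section FreeModule.
Variables (K : comNzRingType) (T : choiceType) (M : lmodType K).
Implicit Types (f : T -> M) (D : {freeg T / K}).

Lemma fglift_linear f : linear (fglift f).
Proof.
have fD := lift_is_additive f.
have f0 : fglift f 0 = 0 by rewrite -(subrr 0) fD subrr.
have addf u v : fglift f (u + v) = fglift f u + fglift f v.
  by rewrite -[v in LHS]opprK fD -[- v]sub0r fD f0 sub0r opprK.
have sumf (s : seq T) (F : T -> {freeg T / K}) :
    fglift f (\sum_(z <- s) F z) = \sum_(z <- s) fglift f (F z).
  by apply: (big_morph (fglift f)).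
move=> a u v; rewrite addf; congr (_ + _).
have -> : a *: u = \sum_(z <- dom u) << a * coeff z u *g z >> by [].
rewrite -[u in RHS]freeg_sumE !sumf scaler_sumr.
by apply: eq_bigr => z _; rewrite !liftU scalerA.
Qed.

HB.instance Definition _ f :=
  GRing.isLinear.Build K {freeg T / K} M _ (fglift f) (fglift_linear f).

Lemma fglift1 f z : fglift f << z >> = f z.
Proof. by rewrite liftU scale1r. Qed.

Lemma freeg_span D : lspan (fun v : {freeg T / K} => exists z, v = << z >>) D.
Proof.
rewrite -(freeg_sumE D); apply: sub_sum => [|z _]; first exact: lspan_subspace.
have -> : << coeff z D *g z >> = coeff z D *: << z >> :> {freeg T / K}.
  by apply/eqP/freeg_eqP => y; rewrite coeffZ !coeffU mul1r.
by apply: subZ; [exact: lspan_subspace | apply: lspan_base; exists z].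
Qed.

End FreeModule.

(** Needed because actions with different fuel are compared only on the words that actually
    occur. *)
Lemma fglift_eq_on (K : comNzRingType) (T : choiceType) (M : lmodType K)
  (P : T -> Prop) (f g : T -> M) D : (forall z, P z -> f z = g z) ->
  lspan (fun v : {freeg T / K} => exists2 z, P z & v = << z >>) D ->
  fglift f D = fglift g D.
Proof.
move=> fg; elim=> [|a _ v [z Pz ->] _ IH]; first by rewrite !linear0.
by rewrite !fglift_linear IH !fglift1 fg.
Qed.

Section CombinationOf.
Variables (R : realType) (V : lmodType (Cx R)).

Definition combo (F : Gen -> V) (s : seq (Cx R * Gen)) : V :=
  \sum_(p <- s) p.1 *: F p.2.

Lemma linear_combo (M : lmodType (Cx R)) (f : {linear V -> M}) F s :
  f (combo F s) = \sum_(p <- s) p.1 *: f (F p.2).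
Proof. by rewrite linear_sum; apply: eq_bigr => p _; rewrite linearZ. Qed.

End CombinationOf.

(** * The module induced from a character, on sorted words *)

Section CosetModel.
Variables (R : realType) (h : pred Gen) (chi : Gen -> Cx R).
Local Notation C := (Cx R).
Local Notation V := {freeg (seq Gen) / C}.

Definition gen_le (x y : Gen) := (pickle x <= pickle y)%N.

Lemma gen_le_total : total gen_le.
Proof. by move=> x y; apply: leq_total. Qed.

Lemma gen_le_trans : transitive gen_le.
Proof. by move=> y x z; apply: leq_trans. Qed.

Lemma gen_le_anti x y : gen_le x y -> gen_le y x -> x = y.
Proof.
move=> xy yx; apply: (pcan_inj pickleK).
by apply/eqP; rewrite eqn_leq; apply/andP.
Qed.

(** These words index the Poincare-Birkhoff-Witt basis of the module induced from the character
    [chi] of the span of [h]. All other words will be sent to zero by every generator. *)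
Definition normal (S : seq Gen) := all (predC h) S && sorted gen_le S.

Lemma normal_consE x S :
  normal (x :: S) = [&& ~~ h x, all (gen_le x) S & normal S].
Proof.
rewrite /normal /= path_sortedE; last exact: gen_le_trans.
by case: (h x) => //=; rewrite andbCA.
Qed.

(* The action on sorted words in the generators outside [h], as in the classical
   proof of Poincare-Birkhoff-Witt: [x y S = y x S + [x, y] S] unless [x] can be
   put in front of [y :: S]. Fuel [size S] suffices because, up to words of
   length at most [size S], [x S] is a sorted rearrangement of [x :: S], in
   front of which [y] is put without any recursive call. *)
Fixpoint act_fuel (p : nat) (x : Gen) (S : seq Gen) : V :=
  if normal (x :: S) then << x :: S >> else
  match p, S with
  | _, [::] => chi x *: << [::] >>
  | p.+1, y :: S' => fglift (act_fuel p y) (act_fuel p x S')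
                     + combo (fun g => act_fuel p g S') (br R x y)
  | 0%N, _ => 0
  end.

Definition act_word x S := act_fuel (size S) x S.

Definition act_shape x S (S' : seq Gen) :=
  normal S' /\ ((size S' <= size S)%N \/ perm_eq S' (x :: S)).

Definition act_span x S :=
  lspan (fun v : V => exists2 S', act_shape x S S' & v = << S' >>).

Lemma act_fuel_normal p x S : normal (x :: S) -> act_fuel p x S = << x :: S >>.
Proof. by case: p => [|p] /= ->. Qed.

(** Since [S'] is normal, [x] lies outside [h]; so the only obstacle to putting [x] before [y] is
    the order. Thus [y] is below [x] and stays the least letter. *)
Lemma normal_insert x y S S' : normal (y :: S) -> ~~ normal (x :: y :: S) ->
  normal S' -> perm_eq S' (x :: S) -> normal (y :: S').
Proof.
rewrite !normal_consE /= => /and3P[hy yS nS].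
rewrite hy yS nS !andbT => nxyS nS' pS'.
have hx : ~~ h x.
  have /andP[/allP hS' _] := nS'; apply: hS'.
  by rewrite (perm_mem pS') mem_head.
have yx : gen_le y x.
  have /orP[xy|//] := gen_le_total x y; case/negP: nxyS.
  rewrite hx xy /=; apply/allP => z /(allP yS); exact: gen_le_trans.
by rewrite nS' andbT (perm_all _ pS') /= yx.
Qed.

(** Support and independence of fuel are proved together: the outer action of [y] runs on the words
    produced by the inner action of [x], and only the shape of these words shows that the fuel
    suffices. *)
Lemma act_fuelP n S : size S = n -> normal S -> forall x,
  act_span x S (act_word x S) /\
  forall p, (n <= p)%N -> act_fuel p x S = act_word x S.
Proof.
have [k] := ubnP n; elim: k n S => // k IH n S; rewrite ltnS => nk Sn nS x.
have [nxS|nxS] := boolP (normal (x :: S)).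
  rewrite /act_word act_fuel_normal //; split=> [|p _]; last exact: act_fuel_normal.
  by apply: lspan_base; exists (x :: S) => //; split=> //; right.
case: S n Sn nS nxS nk => [|y S] [|n] //= => [_|[Sn]] nS nxS nk.
  rewrite /act_word /= (negPf nxS); split.
    2: by case=> [|p]; rewrite /= (negPf nxS).
  apply: subZ; first exact: lspan_subspace.
  by apply: lspan_base; exists [::] => //; split=> //; left.
have [hy yS nS'] : [/\ ~~ h y, all (gen_le y) S & normal S].
  by move: nS; rewrite normal_consE => /and3P.
have IHS g := IH n S nk Sn nS' g.
(* A word of [act_word x S] is either short, which is the induction hypothesis, or a rearrangement
   of [x :: S], in front of which [y] goes without using fuel. *)
have liftE p : (n <= p)%N -> fglift (act_fuel p y) (act_word x S)
    = fglift (act_word y) (act_word x S).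
  move=> np; apply: fglift_eq_on (IHS x).1 => S' [nS'' [sS'|pS']].
    have sn : (size S' < k)%N by apply: leq_ltn_trans nk; rewrite -Sn.
    apply: (IH _ _ sn erefl nS'' y).2.
    by apply: leq_trans np; rewrite -Sn.
  by rewrite /act_word !act_fuel_normal ?(normal_insert nS nxS nS'' pS').
have fuelE p : (n <= p)%N -> act_fuel p.+1 x (y :: S)
   = fglift (act_word y) (act_word x S) + combo (fun g => act_word g S) (br R x y).
  move=> np; rewrite /= (negPf nxS) (IHS x).2 // liftE //; congr (_ + _).
  by apply: eq_bigr => q _; rewrite (IHS q.2).2.
have wordE : act_word x (y :: S) = fglift (act_word y) (act_word x S)
   + combo (fun g => act_word g S) (br R x y).
  by rewrite {1}/act_word /size -/(size S) fuelE // Sn.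
split; last by case=> // p; rewrite ltnS wordE; apply: fuelE.
have sB := @lspan_subspace _ _ (fun v : V =>
  exists2 S', act_shape x (y :: S) S' & v = << S' >>).
rewrite wordE; apply: (subD sB).
  apply: (lspan_preim sB (fglift_linear (act_word y))) (IHS x).1.
  move=> _ [S' [nS'' [sS'|pS']] ->]; rewrite fglift1.
    have sn : (size S' < k)%N by apply: leq_ltn_trans nk; rewrite -Sn.
    apply: lspan_mono (IH _ _ sn erefl nS'' y).1.
    move=> _ [S1 [nS1 S1P] ->]; apply: lspan_base; exists S1 => //.
    split=> //; left=> /=; case: S1P => [/leq_trans-> //|/perm_size->].
      exact: leqW.
    by rewrite /= ltnS.
  rewrite /act_word act_fuel_normal ?(normal_insert nS nxS nS'' pS') //.
  apply: lspan_base; exists (y :: S'); split=> //.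
    exact: normal_insert nS nxS nS'' pS'.
  right; rewrite -(perm_cons y) in pS'; apply: perm_trans pS' _.
  by apply/permP => a /=; rewrite addnCA.
apply: (sub_sum sB) => q _; apply: (subZ sB).
apply: lspan_mono (IHS q.2).1 => _ [S1 [nS1 S1P] ->].
apply: lspan_base; exists S1 => //; split=> //; left=> /=.
by case: S1P => [/leqW //|/perm_size->].
Qed.

Definition model_act (x : Gen) : V -> V :=
  fglift (fun S => if normal S then act_word x S else 0).

HB.instance Definition _ x :=
  GRing.isLinear.Build C V V _ (model_act x) (fglift_linear _).

Definition model_rep (x : Gen) : {linear V -> V} := model_act x.

Local Notation rho := model_rep.
Local Notation e S := (<< S >> : V).

Lemma rho_word x S : normal S -> rho x (e S) = act_word x S.
Proof. by move=> nS; rewrite /= /model_act fglift1 nS. Qed.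

Lemma rho_nonnormal x S : ~~ normal S -> rho x (e S) = 0.
Proof. by move=> nS; rewrite /= /model_act fglift1 (negPf nS). Qed.

Lemma rho_normal x S : normal (x :: S) -> rho x (e S) = e (x :: S).
Proof.
move=> nxS; rewrite rho_word; first exact: act_fuel_normal.
by move: nxS; rewrite normal_consE => /and3P[].
Qed.

Lemma rho_span x S : normal S -> act_span x S (rho x (e S)).
Proof. by move=> nS; rewrite rho_word //; apply: (act_fuelP erefl nS x).1. Qed.

Lemma rho_vacuum x : h x -> rho x (e [::]) = chi x *: e [::].
Proof. by move=> hx; rewrite rho_word // /act_word /= /normal /= hx. Qed.

Lemma rho_cons x y S : normal (y :: S) -> ~~ normal (x :: y :: S) ->
  rho x (e (y :: S)) =
    rho y (rho x (e S)) + combo (fun g => rho g (e S)) (br R x y).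
Proof.
move=> nyS nxyS; have /and3P[_ _ nS] : [&& ~~ h y, all (gen_le y) S & normal S].
  by rewrite -normal_consE.
rewrite rho_word // {1}/act_word /= (negPf nxyS); congr (_ + _); last first.
  by apply: eq_bigr => q _; rewrite rho_word.
rewrite -/(act_word x S) -rho_word //.
apply: fglift_eq_on (rho_span x nS) => S' [nS' [sS'|pS']]; rewrite nS'.
  exact: (act_fuelP erefl nS' y).2.
by rewrite /act_word !act_fuel_normal ?(normal_insert nyS nxyS nS' pS').
Qed.

Lemma combo_coeff (F : Gen -> V) s S :
  coeff S (combo F s) = lin (fun g => coeff S (F g)) s.
Proof. by rewrite raddf_sum; apply: eq_bigr => q _; apply: coeffZ. Qed.

Lemma combo_anti (F : Gen -> V) x y : combo F (br R x y) = - combo F (br R y x).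
Proof.
by apply/eqP/freeg_eqP => S; rewrite coeffN !combo_coeff br_anti.
Qed.

Lemma combo_jacobi (F : Gen -> V) x y z :
  combo (fun g => combo F (br R x g)) (br R y z)
  - combo (fun g => combo F (br R y g)) (br R x z)
  = combo (fun g => combo F (br R g z)) (br R x y).
Proof.
apply/eqP/freeg_eqP => S; rewrite coeffB !combo_coeff.
have lin_combo (r : Gen -> seq (C * Gen)) s :
    lin (fun g => coeff S (combo F (r g))) s =
    lin (fun g => lin (fun g' => coeff S (F g')) (r g)) s.
  by apply: eq_bigr => q _; rewrite combo_coeff.
by rewrite !lin_combo br_jacobi.
Qed.

Lemma eq_combo (F G : Gen -> V) s : F =1 G -> combo F s = combo G s.
Proof. by move=> FG; apply: eq_bigr => q _; rewrite FG. Qed.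

Lemma comboD (F G : Gen -> V) s :
  combo (fun g => F g + G g) s = combo F s + combo G s.
Proof. by rewrite -big_split; apply: eq_bigr => q _; rewrite scalerDr. Qed.

Let brk x y v := combo (fun g => rho g v) (br R x y).

Let commutes x y v := rho x (rho y v) = rho y (rho x v) + brk x y v.

Let brk_linear x y : linear (brk x y).
Proof.
move=> a u v; rewrite /brk scaler_sumr -big_split; apply: eq_bigr => q _.
by rewrite linearP scalerDr !scalerA mulrC.
Qed.

Let commutes_sym x y v : commutes x y v -> commutes y x v.
Proof.
by rewrite /commutes /brk => ->; rewrite (combo_anti _ y) addrK.
Qed.

Let commutes_lspan x y (B : V -> Prop) v :
  (forall u, B u -> commutes x y u) -> lspan B v -> commutes x y v.
Proof.
move=> Bc; elim=> [|a u t Bu _ IH].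
  rewrite /commutes /brk /combo !linear0 big1 ?addr0 // => q _.
  by rewrite linear0 scaler0.
rewrite /commutes !linearP brk_linear (Bc _ Bu) IH.
by rewrite scalerDr !addrA; congr (_ + _); rewrite addrAC.
Qed.

(** If [x] cannot precede [y :: S], this is the defining recursion. If it can and [x] differs from
    [y], then [y] cannot precede [x :: S], and the recursion applies with the roles exchanged. For
    [x = y] the bracket vanishes by antisymmetry. *)
Lemma commutes_normal x y S : normal (y :: S) -> commutes x y (e S).
Proof.
move=> nyS; have := nyS; rewrite normal_consE => /and3P[hy yS nS].
rewrite /commutes (rho_normal nyS).
have [nxyS|nxyS] := boolP (normal (x :: y :: S)); last exact: rho_cons.
have [xy|xy] := eqVneq x y.
  rewrite -{}xy in nyS *; rewrite -(rho_normal nyS) /brk; apply/eqP.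
  rewrite -subr_eq0 opprD addrA subrr sub0r oppr_eq0.
  have /eqP := combo_anti (fun g => rho g (e S)) x x.
  by rewrite -addr_eq0 -mulr2n -scaler_nat scaler_eq0 pnatr_eq0.
have := nxyS; rewrite normal_consE => /and3P[hx /= /andP[lxy xS] _].
have nxS : normal (x :: S) by rewrite normal_consE hx xS.
have nyxS : ~~ normal (y :: x :: S).
  rewrite normal_consE /=; apply/negP => /and3P[_ /andP[lyx _] _].
  by rewrite (gen_le_anti lxy lyx) eqxx in xy.
rewrite -(rho_normal nyS); apply: (@commutes_sym y x).
by rewrite /commutes (rho_normal nxS) rho_cons.
Qed.

Hypothesis h_closed : forall a b, h a -> h b -> forall p, p \in br R a b -> h p.2.
Hypothesis chi_lin : forall a b, h a -> h b -> lin chi (br R a b) = 0.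

Let not_normal1 x : ~~ normal [:: x] -> h x.
Proof. by rewrite normal_consE /= andbT => /negPn. Qed.

(** In the remaining case neither generator fits in front of [z :: S]. Both products are expanded by
    moving [z] to the left, and the Jacobi identity matches the double brackets. *)
Lemma commutes_word n S x y : size S = n -> normal S -> commutes x y (e S).
Proof.
have [k] := ubnP n; elim: k n S x y => // k IH n S x y; rewrite ltnS => nk Sn nS.
have [nyS|nyS] := boolP (normal (y :: S)); first exact: commutes_normal.
have [nxS|nxS] := boolP (normal (x :: S)).
  by apply: commutes_sym; apply: commutes_normal.
case: S Sn nS nxS nyS => [|z S] Sn nS nxS nyS.
  (* On the empty word both generators must lie in [h]; they act by scalars, and [chi] kills their
     bracket. *)
  have [hx hy] := (not_normal1 nxS, not_normal1 nyS).
  have rhoZ g a v : rho g (a *: v) = a *: rho g v by apply: linearZ.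
  rewrite /commutes (rho_vacuum hy) (rho_vacuum hx) !rhoZ !rho_vacuum // /brk.
  rewrite !scalerA mulrC -[LHS]addr0; congr (_ + _); apply/esym.
  transitivity (lin chi (br R x y) *: e [::]); last by rewrite chi_lin ?scale0r.
  rewrite /lin scaler_suml; apply: eq_big_seq => q qxy.
  by rewrite rho_vacuum ?scalerA // (h_closed hx hy).
have nS' : normal S by move: nS; rewrite normal_consE => /and3P[].
have ltS : (size S < k)%N by apply: leq_trans nk; rewrite -Sn.
have cS g g' : commutes g g' (e S) by exact: (IH _ S g g' ltS erefl nS').
(* The words of [rho g' (e S)] are no longer than [S], or are rearrangements of [g' :: S] that [z]
   can precede. *)
have cz g g' : ~~ normal (g' :: z :: S) -> commutes g z (rho g' (e S)).
  move=> ngzS; apply: commutes_lspan (rho_span g' nS') => _ [S' [nS1 [sS'|pS']] ->].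
    exact: (IH _ S' g z (leq_ltn_trans sS' ltS) erefl nS1).
  by apply: commutes_normal; apply: normal_insert nS ngzS nS1 pS'.
have expand g g' : ~~ normal (g' :: z :: S) -> rho g (rho g' (e (z :: S))) =
    rho z (rho g (rho g' (e S))) + brk g z (rho g' (e S)) +
    (brk g' z (rho g (e S)) + combo (fun q => brk g q (e S)) (br R g' z)).
  move=> ng'; rewrite rho_cons // linearD cz //; congr (_ + _).
  rewrite linear_combo -comboD; apply: eq_bigr => q _.
  by rewrite (cS g q.2).
rewrite /commutes !expand // (cS x y) linearD linear_combo.
(* [[x, y] z S = z [x, y] S + [[x, y], z] S], where Jacobi splits the last term into [[x, [y, z]] S
   - [y, [x, z]] S]. *)
have -> : brk x y (e (z :: S)) =
    combo (fun q => rho z (rho q (e S))) (br R x y) +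
    (combo (fun q => brk x q (e S)) (br R y z)
     - combo (fun q => brk y q (e S)) (br R x z)).
  rewrite /brk combo_jacobi -comboD; apply: eq_combo => g.
  by rewrite -(rho_normal nS) (cS g z).
have rearrange (a b c p j1 j2 : V) :
    a + p + b + (c + j1) = a + c + (b + j2) + (p + (j1 - j2)).
  rewrite !addrA (addrAC _ j2 p) (addrAC _ j2 j1) addrK; congr (_ + _).
  by rewrite (addrAC a c b) (addrAC _ c p) (addrAC a b p).
exact: rearrange.
Qed.

Lemma model_is_rep : is_rep rho.
Proof.
move=> x y v; apply/eqP; rewrite subr_eq addrC; apply/eqP.
apply: commutes_lspan (freeg_span v) => _ [S ->].
have [nS|nS] := boolP (normal S); first exact: commutes_word nS.
rewrite /commutes !(rho_nonnormal _ nS) !linear0 add0r /brk /combo big1 // => q _.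
by rewrite rho_nonnormal ?scaler0.
Qed.

End CosetModel.

Lemma vacuum_neq0 (R : realType) : << [::] >> != 0 :> {freeg (seq Gen) / Cx R}.
Proof. by rewrite freegU_eq0 oner_eq0. Qed.

(** * Reducibility *)

Section Subrepresentation.
Variables (R : realType) (W : lmodType (Cx R)) (rho : Gen -> {linear W -> W}).
Variables (S : W -> Prop) (sS : submodule rho S).

(** Classical boolean membership turns [S] into a left module, to which the universal property can
    be applied. *)
Definition sub_pred : {pred W} := fun v => `[< S v >].

Fact sub_pred_closed : submod_closed sub_pred.
Proof.
have [S0 SD _] := sS; split; first exact/asboolP.
by move=> a u v /asboolP Su /asboolP Sv; apply/asboolP/SD.
Qed.

HB.instance Definition _ :=
  GRing.isSubmodClosed.Build (Cx R) W sub_pred sub_pred_closed.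

Record subrep := SubRep { subrep_val : W; subrep_valP : subrep_val \in sub_pred }.

HB.instance Definition _ := [isSub for subrep_val].
HB.instance Definition _ := [Choice of subrep by <:].
HB.instance Definition _ := [SubChoice_isSubLmodule of subrep by <:].

Fact subrep_act_subproof b (u : subrep) : rho b (val u) \in sub_pred.
Proof.
by have [_ _ Srho] := sS; apply/asboolP/Srho/asboolP; apply: (valP u).
Qed.

Definition subrep_act b (u : subrep) := SubRep (subrep_act_subproof b u).

Fact subrep_act_linear b : linear (subrep_act b).
Proof. by move=> a u v; apply: val_inj; rewrite /= !linearP. Qed.

HB.instance Definition _ b :=
  GRing.isLinear.Build (Cx R) subrep subrep _ (subrep_act b) (subrep_act_linear b).

Definition subrep_rep b : {linear subrep -> subrep} := subrep_act b.

Lemma subrep_is_rep : is_rep rho -> is_rep subrep_rep.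
Proof.
move=> hrep a b v; apply: val_inj; rewrite raddfB [LHS]hrep /actv.
by rewrite raddf_sum; apply: eq_bigr.
Qed.

Lemma subrep_whittaker m n psi w (Sw : w \in sub_pred) :
  whittaker_vec m n psi rho w -> whittaker_vec m n psi subrep_rep (SubRep Sw).
Proof. by move=> hw b hb; apply: val_inj; rewrite /= hw. Qed.

(** The universal map to the submodule, followed by the inclusion, fixes [w]; by uniqueness it is
    the identity of [W]. *)
Lemma induced_generated m n psi w :
  induced_whittaker m n psi rho w -> S w -> forall v, S v.
Proof.
move=> [hrep hw hW] /asboolP Sw v.
have [[f [fI fw]] _] := hW _ subrep_rep (SubRep Sw)
  (subrep_is_rep hrep) (subrep_whittaker Sw hw).
have [_ unique] := hW _ rho w hrep hw.
have fv : val (f v) = v.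
  apply: (unique (val \o f) idfun) => [b u| | |] //=; first by rewrite fI.
  by rewrite fw.
by rewrite -fv; apply/asboolP; apply: (valP (f v)).
Qed.

End Subrepresentation.

Section Existence.
Variable R : realType.
Local Notation C := (Cx R).

Lemma character_module (h : pred Gen) (chi : Gen -> C) :
  (forall a b, h a -> h b -> forall p, p \in br R a b -> h p.2) ->
  (forall a b, h a -> h b -> lin chi (br R a b) = 0) ->
  exists (V : lmodType C) (sigma : Gen -> {linear V -> V}) (v : V),
    [/\ is_rep sigma, forall b, h b -> sigma b v = chi b *: v & v != 0].
Proof.
move=> hc hl; exists {freeg (seq Gen) / C}, (model_rep h chi), << [::] >>.
split; [exact: model_is_rep | exact: rho_vacuum | exact: vacuum_neq0].
Qed.

End Existence.

(** * Enlarged characters and proper submodules *)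

Section WhittakerFunction.
Variables (R : realType) (m n : nat) (psi : Gen -> Cx R).
Hypotheses (m_gt0 : (0 < m)%N) (psiP : whittaker_fun m n psi).
Local Notation N := (m + n - 1)%N%:Z.

(** [I_k = [H_m, I_(k-m)]], and [k - m >= n] because [k > m + n - 1]. *)
Lemma psi_gI (k : int) : N < k -> psi (gI k) = 0.
Proof.
move=> Nk; have := @psiP (gH m%:Z) (gI (k - m%:Z)) _ _.
rewrite /lin big_seq1 /= mul1r (addrC m%:Z) subrK; apply => //; lia.
Qed.

Lemma psi_gJ (k : int) : N < k -> psi (gJ k) = 0.
Proof.
move=> Nk; have := @psiP (gH m%:Z) (gJ (k - m%:Z)) _ _.
rewrite /lin big_seq1 /= mulN1r (addrC m%:Z) subrK => h.
by apply/eqP; rewrite -oppr_eq0 h //; lia.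
Qed.

(* When [psi] vanishes on [gI N] (resp. [gJ N]), the subalgebra can be enlarged
   by [gI (n - 1)] (resp. [gJ (n - 1)]), on which the character is arbitrary. *)
Lemma enlarged_character_module (bI bJ : bool) (t : Cx R) :
  (bI -> psi (gI N) = 0) -> (bJ -> psi (gJ N) = 0) ->
  exists (V : lmodType (Cx R)) (sigma : Gen -> {linear V -> V}) (v : V),
    [/\ is_rep sigma, whittaker_vec m n psi sigma v, v != 0,
        bI -> sigma (gI (n%:Z - 1)) v = t *: v
      & bJ -> sigma (gJ (n%:Z - 1)) v = t *: v].
Proof.
move=> hI hJ.
pose h g := match g with
  | gL i | gH i => m%:Z <= i
  | gI i => n%:Z - bI%:Z <= i
  | gJ i => n%:Z - bJ%:Z <= i
  | _ => true
  end.
pose chi g := match g with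
  | gI k => if bI && (k == n%:Z - 1) then t else psi g
  | gJ k => if bJ && (k == n%:Z - 1) then t else psi g
  | _ => psi g
  end.
(* As [m > 0], the sum [i + j] is at least [n], so the free value [t] is never met. The enlargement
   adds only the index [i + j = N], where [hI] applies. *)
have chiI i j : m%:Z <= i -> n%:Z - bI%:Z <= j -> chi (gI (i + j)) = 0.
  move=> mi nj; rewrite /chi ifF; last by apply/negP; lia.
  have [|le_ijN] := ltP N (i + j); first exact: psi_gI.
  have bIT : bI by case: (bI) nj => //; lia.
  by have -> : i + j = N; [case: (bI) nj; lia | exact: hI].
have chiJ i j : m%:Z <= i -> n%:Z - bJ%:Z <= j -> chi (gJ (i + j)) = 0.
  move=> mi nj; rewrite /chi ifF; last by apply/negP; lia.
  have [|le_ijN] := ltP N (i + j); first exact: psi_gJ.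
  have bJT : bJ by case: (bJ) nj => //; lia.
  by have -> : i + j = N; [case: (bJ) nj; lia | exact: hJ].
have [V [sigma [v [hrep hv v0]]]] : exists (V : lmodType (Cx R))
    (sigma : Gen -> {linear V -> V}) (v : V),
    [/\ is_rep sigma, forall g, h g -> sigma g v = chi g *: v & v != 0].
  apply: character_module => [x y|x y].
    by case: x => [i|i|i|i|||]; case: y => [j|j|j|j|||] //= hx hy p;
      rewrite /delta0; try (case: eqP => _); rewrite ?in_nil ?inE //;
      (case/orP => /eqP-> || move/eqP->) => //=; lia.
  case: x => [i|i|i|i|||]; case: y => [j|j|j|j|||] //= hx hy;
    rewrite ?lin_nil // ?(lin_cons, lin_delta0, lin_nil) /=;
    rewrite -?[if _ then _ else _]/(chi (gI _)) -?[if _ then _ else _]/(chi (gJ _));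
    try by rewrite ?chiI ?chiJ // mulr0 addr0.
  - have := @psiP (gL i) (gL j) hx hy.
    by rewrite ?(lin_cons, lin_delta0, lin_nil) /=.
  - have := @psiP (gL i) (gH j) hx hy.
    by rewrite ?(lin_cons, lin_delta0, lin_nil) /=.
  - have := @psiP (gH i) (gL j) hx hy.
    by rewrite ?(lin_cons, lin_delta0, lin_nil) /=.
  - have := @psiP (gH i) (gH j) hx hy.
    by rewrite ?(lin_cons, lin_delta0, lin_nil) /=.
exists V, sigma, v; split=> // [g hg|bIT|bJT].
- have hhg : h g by case: g hg => [i|i|i|i|||] //=; lia.
  rewrite hv //; congr (_ *: _); case: g hg {hhg} => [i|i|i|i|||] //= hi;
    by rewrite ifF //; apply/negP; lia.
- by rewrite hv /= ?bIT ?eqxx.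
- by rewrite hv /= ?bJT ?eqxx.
Qed.

Lemma not_irreducible_of_free_eigenvalue (W : lmodType (Cx R))
  (rho : Gen -> {linear W -> W}) (w : W) g : induced_whittaker m n psi rho w ->
  (forall t : Cx R, exists (V : lmodType (Cx R)) (sigma : Gen -> {linear V -> V}) v,
    [/\ is_rep sigma, whittaker_vec m n psi sigma v, v != 0 & sigma g v = t *: v]) ->
  ~ irreducible rho.
Proof.
move=> [hrep hw hW] free [_ simple].
have [V [sigma [v [hs hv /eqP v0 gv]]]] := free 0.
have [V' [tau [v' [ht hv' /eqP v'0 gv']]]] := free 1.
have [[f [fI fw]] _] := hW V sigma v hs hv.
have [[f' [f'I f'w]] _] := hW V' tau v' ht hv'.
have [|ker0|kerW] := simple (fun u => f u = 0).
- split=> [|a u u' fu fu'|b u fu]; first exact: linear0.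
    by rewrite linearP fu fu' scaler0 addr0.
  by rewrite fI fu linear0.
- have gw : rho g w = 0 by apply: ker0; rewrite fI fw gv scale0r.
  by apply: v'0; rewrite -[v']scale1r -gv' -f'w -f'I gw linear0.
- by apply: v0; rewrite -fw.
Qed.

Lemma not_irreducible (W : lmodType (Cx R)) (rho : Gen -> {linear W -> W}) (w : W) :
  induced_whittaker m n psi rho w -> psi (gI N) * psi (gJ N) = 0 ->
  ~ irreducible rho.
Proof.
move=> hW /eqP; rewrite mulf_eq0 => /orP[/eqP a0|/eqP b0].
  apply: (not_irreducible_of_free_eigenvalue (g := gI (n%:Z - 1)) hW) => t.
  have [//|V [sigma [v [h1 h2 h3 h4 _]]]] :=
    @enlarged_character_module true false t (fun=> a0).
  by exists V, sigma, v; split=> //; apply: h4.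
apply: (not_irreducible_of_free_eigenvalue (g := gJ (n%:Z - 1)) hW) => t.
have [//|//|V [sigma [v [h1 h2 h3 _ h4]]]] :=
  @enlarged_character_module false true t.
by exists V, sigma, v; split=> //; apply: h4.
Qed.

(** The universal property does not mention that [w] is nonzero; this follows by mapping [w] to the
    nonzero vector of the sorted-word model for [psi] itself. *)
Lemma whittaker_vec_neq0 (W : lmodType (Cx R)) (rho : Gen -> {linear W -> W})
  (w : W) :
  induced_whittaker m n psi rho w -> w != 0.
Proof.
move=> [_ _ hW].
have [//|//|V [sigma [v [h1 h2 v0 _ _]]]] :=
  @enlarged_character_module false false 0.
have [[f [_ fw]] _] := hW V sigma v h1 h2.
by apply: contraNneq v0 => w0; rewrite -fw w0 linear0.
Qed.

End WhittakerFunction.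

(** * Irreducibility *)

Section Irreducible.
Variables (R : realType) (m n : nat) (psi : Gen -> Cx R).
Variables (W : lmodType (Cx R)) (rho : Gen -> {linear W -> W}) (w : W).
Hypotheses (m_gt0 : (0 < m)%N) (odd_mn : odd m = odd n).
Hypotheses (psiP : whittaker_fun m n psi) (rhoP : is_rep rho)
  (wP : whittaker_vec m n psi rho w).
Local Notation N := (m + n - 1)%N%:Z.
Local Notation a := (psi (gI N)).
Local Notation b := (psi (gJ N)).
Hypotheses (a_neq0 : a != 0) (b_neq0 : b != 0).

Let psiI0 k : N < k -> psi (gI k) = 0 := @psi_gI R m n psi m_gt0 psiP k.
Let psiJ0 k : N < k -> psi (gJ k) = 0 := @psi_gJ R m n psi m_gt0 psiP k.

(** Equal parity of [m] and [n] makes [N] odd; this keeps the pairings of [L], [H] with [I], [J]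
    nondegenerate. *)
Lemma N_neq_double (i : int) : N - i - i != 0.
Proof.
have N_odd : odd (m + n - 1) by rewrite oddB ?oddD ?odd_mn ?addbb //; lia.
apply/eqP => Ni; have {Ni} : N = i * 2 by lia.
rewrite -(odd_double_half (m + n - 1)) N_odd; lia.
Qed.

Definition idx g : int :=
  match g with gL i | gH i | gI i | gJ i => i | _ => 0 end.

Definition is_IJ g := match g with gI _ | gJ _ => true | _ => false end.

Definition is_LH g := match g with gL _ | gH _ => true | _ => false end.

Definition letter_Y g := is_IJ g && (idx g < n%:Z).

Definition letter_X g := is_LH g && (idx g < m%:Z).

(** With [brc] below, for [z] an [I] or [J] and [g] an [L] or [H], the bracket [[z, g]] is the
    single term [brc z g] times [shift z (idx g)]. *)
Definition shift z (i : int) :=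
  match z with gI k => gI (i + k) | gJ k => gJ (i + k) | _ => z end.

Definition brc z g : Cx R :=
  match z, g with
  | gI k, gL i => (i - k)%:~R
  | gI _, gH _ => -1
  | gJ k, gL i => (i - k)%:~R
  | gJ _, gH _ => 1
  | _, _ => 0
  end.

Lemma shift_IJ z i : is_IJ z -> is_IJ (shift z i).
Proof. by case: z. Qed.

Lemma idx_shift z i : is_IJ z -> idx (shift z i) = i + idx z.
Proof. by case: z. Qed.

Lemma rhoD x u v : rho x (u + v) = rho x u + rho x v.
Proof. exact: linearD. Qed.

Lemma rhoB x u v : rho x (u - v) = rho x u - rho x v.
Proof. exact: linearB. Qed.

Lemma rhoZ x c v : rho x (c *: v) = c *: rho x v.
Proof. exact: linearZ. Qed.

Lemma rho_comm x y v : rho x (rho y v) = rho y (rho x v) + actv rho (br R x y) v.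
Proof. by rewrite -rhoP addrC subrK. Qed.

Lemma rho_IJ_LH z g v : is_IJ z -> is_LH g ->
  rho z (rho g v) = rho g (rho z v) + brc z g *: rho (shift z (idx g)) v.
Proof.
move=> hz hg; rewrite rho_comm; congr (_ + _).
by case: z hz => // k _; case: g hg => // i _; rewrite /actv big_seq1.
Qed.

Lemma rho_LH_IJ z g v : is_IJ z -> is_LH g ->
  rho g (rho z v) = rho z (rho g v) - brc z g *: rho (shift z (idx g)) v.
Proof. by move=> hz hg; rewrite (rho_IJ_LH v hz hg) addrK. Qed.

Lemma rho_IJ_IJ y z v : is_IJ y -> is_IJ z -> rho y (rho z v) = rho z (rho y v).
Proof.
move=> hy hz; rewrite rho_comm [actv _ _ _]big1_seq ?addr0 //.
by case: y hy => // k _; case: z hz => // i _.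
Qed.

Definition cut (P : Gen) (v : W) : W := rho P v - psi P *: v.

Fact cut_linear P : linear (cut P).
Proof.
move=> c u v; rewrite /cut linearP [psi P *: _]scalerDr opprD addrACA.
by rewrite scalerBr !scalerA [_ * c]mulrC.
Qed.

HB.instance Definition _ P :=
  GRing.isLinear.Build (Cx R) W W _ (cut P) (cut_linear P).

Definition dual_op (al be : Cx R) (P Q : Gen) (v : W) : W :=
  al *: cut P v + be *: cut Q v.

Fact dual_op_linear al be P Q : linear (dual_op al be P Q).
Proof.
move=> c u v; rewrite /dual_op !cut_linear !scalerDr !scalerA addrACA.
by rewrite [_ * c]mulrC [be * c]mulrC.
Qed.

HB.instance Definition _ al be P Q :=
  GRing.isLinear.Build (Cx R) W W _ (dual_op al be P Q) (dual_op_linear al be P Q).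

(** * The filtration by degree in [I] and [J] *)

Definition filt_Y := filt rho letter_Y (fun v => v = w).

Lemma filt_Y_ind d (Q : W -> Prop) : subspace Q ->
  (forall s, all letter_Y s -> (size s < d)%N -> Q (word rho s w)) ->
  forall v, filt_Y d v -> Q v.
Proof.
move=> sQ Qw v; apply: (lspan_sub sQ) => _ [s [_ [Ys sd -> ->]]].
exact: Qw.
Qed.

(** All [I] and [J] commute, so the eigenvalue of [z] at [w] passes through every word. *)
Lemma filt_Y_scalar z d v : is_IJ z -> n%:Z <= idx z -> filt_Y d v ->
  rho z v = psi z *: v.
Proof.
move=> hz nz; move: v; apply: (@filt_Y_ind d (fun v => rho z v = psi z *: v)).
  split=> [|c u v hu hv]; first by rewrite linear0 scaler0.
  by rewrite linearP hu hv scalerDr !scalerA mulrC.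
elim=> [_ _|y s IH /= /andP[/andP[hy _] Ys] sd].
  by apply: wP; case: z hz nz.
by rewrite rho_IJ_IJ // IH ?linearZ // ltnW.
Qed.

Lemma filt_Y_IJ z d v : is_IJ z -> filt_Y d v -> filt_Y d.+1 (rho z v).
Proof.
move=> hz Fv; have [nz|zn] := lerP n%:Z (idx z).
  rewrite (filt_Y_scalar hz nz Fv); apply: subZ; first exact: filt_subspace.
  exact: filtW Fv.
by apply: filt_letter Fv; rewrite /letter_Y hz.
Qed.

Lemma filt_Y_LH g d v : is_LH g -> m%:Z <= idx g -> filt_Y d v ->
  filt_Y d (rho g v).
Proof.
move=> hg mg Fv.
apply: (lspan_preim (f := rho g) (filt_subspace rho letter_Y _ d) _ _ Fv).
  exact: linearP.
move=> _ [s [_ [Ys sd -> ->]]]; apply: filtW sd _.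
elim: s Ys => [_|y s IH /andP[Yy Ys]] /=.
  rewrite wP; last by case: g hg mg.
  apply: subZ; first exact: filt_subspace.
  by apply: (@filt_word _ _ _ _ _ _ 1 [::]).
have /andP[hy _] := Yy; rewrite rho_LH_IJ //.
apply: (subB (filt_subspace _ _ _ _)).
  by apply: filt_letter => //; apply: IH.
apply: subZ; first exact: filt_subspace.
by apply: filt_Y_IJ; [exact: shift_IJ|apply: filt_word].
Qed.

(* The coefficients invert the matrix of the pairing [psi [g, x]] between
   [L_k, H_k] and [I_j, J_j], [k = N - j], so that [dual_Y x] differentiates with
   respect to [x]; likewise for [dual_X] below. *)
Definition dual_Y (x : Gen) : {linear W -> W} :=
  let k := N - idx x in let q : Cx R := (idx x - k)%:~R in
  match x with
  | gI _ => dual_op (2 * q * a)^-1 (2 * a)^-1 (gL k) (gH k)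
  | _ => dual_op (2 * q * b)^-1 (- (2 * b)^-1) (gL k) (gH k)
  end.

(** Commuting [L] or [H] of index [N - idx x] past [y] leaves an [I] or [J] of index at least
    [N >= n], which acts by [psi]. This vanishes above [N], so only [idx y = idx x] contributes, and
    there the coefficients invert the pairing. *)
Lemma dual_Y_der d x y v : letter_Y x -> letter_Y y -> idx x <= idx y ->
  filt_Y d v -> dual_Y x (rho y v) = rho y (dual_Y x v) + (x == y)%:R *: v.
Proof.
move=> /andP[hx nx] /andP[hy ny] xy Fv.
have cutE g : is_LH g -> idx g = N - idx x -> cut g (rho y v) =
    rho y (cut g v) - (brc y g * psi (shift y (idx g))) *: v.
  move=> hg gx; rewrite /cut rhoB rhoZ rho_LH_IJ //.
  rewrite (@filt_Y_scalar _ d v (shift_IJ _ hy)) //; last first.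
    by rewrite idx_shift // gx; lia.
  by rewrite scalerA addrAC.
have dualE al be : dual_op al be (gL (N - idx x)) (gH (N - idx x)) (rho y v) =
    rho y (dual_op al be (gL (N - idx x)) (gH (N - idx x)) v)
    - ((al * brc y (gL (N - idx x)) + be * brc y (gH (N - idx x)))
       * psi (shift y (N - idx x))) *: v.
  rewrite /dual_op !cutE // (rhoD y (al *: _)) !rhoZ !scalerBr !scalerA addrACA /=.
  by rewrite -opprD -scalerDl !mulrA mulrDl.
have qE (i : int) : (i - (N - i))%:~R != 0 :> Cx R.
  by rewrite intr_eq0; have := N_neq_double i; lia.
have coef al be : - ((al * brc y (gL (N - idx x)) + be * brc y (gH (N - idx x)))
    * psi (shift y (N - idx x))) = (x == y)%:R ->
    dual_op al be (gL (N - idx x)) (gH (N - idx x)) (rho y v) =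
    rho y (dual_op al be (gL (N - idx x)) (gH (N - idx x)) v) + (x == y)%:R *: v.
  by move=> <-; rewrite dualE scaleNr.
case: x hx nx xy cutE dualE coef => // i _ ni;
  case: y hy ny => // j _ nj ij _ _ coef;
  apply: coef; move: ij; rewrite /= le_eqVlt => /orP[/eqP <-|ij];
  rewrite ?subrK ?eqxx /=.
all: try (have Nij : N < N - i + j by lia);
  try (rewrite ?(psiI0 Nij) ?(psiJ0 Nij) mulr0 oppr0;
    first [done | by case: eqP => // -[]; lia]).
all: have := qE i; set q : Cx R := (i - (N - i))%:~R => q0;
  have -> : (N - i - i)%:~R = - q :> Cx R by rewrite -rmorphN; congr (_%:~R); lia.
all: by clearbody q; field; rewrite ?a_neq0 ?b_neq0 ?q0.
Qed.

Lemma cut_vec g : inSub m n g -> cut g w = 0.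
Proof. by move=> hg; rewrite /cut wP // subrr. Qed.

(** From [i < n] follows [N - i >= m], so both operators lie in the subalgebra. *)
Lemma dual_Y_vec x : letter_Y x -> dual_Y x w = 0.
Proof.
case: x => // i /andP[/= _ ni];
  rewrite /= /dual_op !cut_vec ?scaler0 ?addr0 //=; lia.
Qed.

Section TrivialIntersection.
Variable U : W -> Prop.
Hypotheses (sU : submodule rho U) (notUw : ~ U w).

Let subU : subspace U.
Proof. by case: sU. Qed.

Lemma dual_op_sub al be P Q v : U v -> U (dual_op al be P Q v).
Proof.
have [_ _ Urho] := sU => Uv.
by apply: (subD subU); apply: (subZ subU); apply: (subB subU);
  [apply: Urho | apply: (subZ subU) | apply: Urho | apply: (subZ subU)].
Qed.

Lemma filt_Y_trivial d v : U v -> filt_Y d v -> v = 0.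
Proof.
move: d v; apply: (filt_trivial_exact (A := dual_Y) (idx := idx)).
- by move=> x y v /andP[hx _] /andP[hy _]; apply: rho_IJ_IJ.
- by move=> x _ Yx ->; apply: dual_Y_vec.
- exact: dual_Y_der.
- by case=> // i v _ Uv; apply: dual_op_sub.
(* In degree zero only multiples of [w] remain, and a nonzero one would put [w] in [U]. *)
move=> v Uv Fv; have [c vE] : exists c, v = c *: w.
  elim: Fv {Uv} => [|c u t [s [w' [_ ss w'E uE]]] _ [c' ->]].
    by exists 0; rewrite scale0r.
  have -> : u = w by rewrite uE w'E; case: s ss {uE}.
  by exists (c + c'); rewrite scalerDl.
have [c0|c_neq0] := eqVneq c 0; first by rewrite vE c0 scale0r.
case: notUw; rewrite -[w]scale1r -(mulVf c_neq0) -scalerA -vE.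
exact: (subZ subU).
Qed.

End TrivialIntersection.

(** * The filtration by degree in [L] and [H] *)

Definition base_X v := exists d, filt_Y d v.

Definition filt_X := filt rho letter_X base_X.

Let sX d : subspace (filt_X d) := filt_subspace rho letter_X base_X d.

(** Passing a letter either keeps [z] or deletes the letter and shifts [z]; in the end [z] is
    absorbed by the base, where words in [I], [J] may have any length. *)
Lemma filt_X_IJ z d v : is_IJ z -> filt_X d v -> filt_X d (rho z v).
Proof.
move=> hz Fv; apply: (lspan_preim (f := rho z) (sX d) _ _ Fv); first exact: linearP.
move=> _ [s [u [Xs sd Bu ->]]]; apply: filtW sd _.
elim: s z hz Xs => [|x s IH] z hz /=.
  move=> _; apply: (@filt_word _ _ _ _ _ _ 1 [::]) => //.
  by case: Bu => e Fu; exists e.+1; apply: filt_Y_IJ.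
move=> /andP[Xx Xs]; have /andP[hx _] := Xx.
rewrite rho_IJ_LH //; apply: (subD (sX _)).
  by apply: filt_letter => //; apply: IH.
apply: (subZ (sX _)); apply: filtW (leqnSn _) _.
by apply: IH => //; apply: shift_IJ.
Qed.

(** These generators span a subalgebra, so reordering [L] and [H] never creates an [I] or [J]. *)
Definition is_LHc g := ~~ is_IJ g.

Lemma br_LHc x y p : is_LHc x -> is_LHc y -> p \in br R x y -> is_LHc p.2.
Proof.
by case: x => [i|i|i|i|||]; case: y => [j|j|j|j|||] //= _ _; rewrite /delta0;
  try (case: eqP => _); rewrite ?in_nil ?inE //; (case/orP => /eqP-> || move/eqP->).
Qed.

Lemma filt_Y_central g d v : is_LHc g -> ~~ is_LH g -> filt_Y d v ->
  rho g v = psi g *: v.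
Proof.
move=> hg hg'; move: v; apply: (@filt_Y_ind d (fun v => rho g v = psi g *: v)).
  split=> [|c u v hu hv]; first by rewrite linear0 scaler0.
  by rewrite linearP hu hv scalerDr !scalerA mulrC.
elim=> [_ _|y s IH /= /andP[/andP[hy _] Ys] sd].
  by apply: wP; case: g hg hg'.
rewrite rho_comm IH ?rhoZ //; last exact: ltnW.
by rewrite [actv _ _ _]big1_seq ?addr0 //; case: g hg hg' {IH} => //; case: y hy.
Qed.

Lemma filt_X_LHc g d v : is_LHc g -> filt_X d v -> filt_X d.+1 (rho g v).
Proof.
move=> hg Fv; apply: (lspan_preim (f := rho g) (sX _) _ _ Fv); first exact: linearP.
move=> _ [s [u [Xs sd Bu ->]]].
suff Fs : filt_X (size s).+2 (rho g (word rho s u)) by apply: filtW Fs.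
elim: s g hg Xs {sd} => [|x s IH] g hg /=.
  move=> _; case Lg : (letter_X g).
    by apply: (@filt_word _ _ _ _ _ _ 2 [:: g]) => //=; rewrite Lg.
  apply: (@filt_word _ _ _ _ _ _ 2 [::]) => //.
  case: Bu => e Fu; exists e; have [LHg|LHg] := boolP (is_LH g).
    by apply: filt_Y_LH => //; move: Lg; rewrite /letter_X LHg /= ltNge => /negbFE.
  by rewrite (filt_Y_central hg LHg Fu); apply: subZ (filt_subspace _ _ _ _) _ _ Fu.
move=> /andP[Xx Xs]; have /andP[hx _] := Xx; have hcx : is_LHc x by case: x hx {Xx}.
rewrite rho_comm; apply: (subD (sX _)).
  by apply: filt_letter => //; apply: IH.
apply: (sub_sum (sX _)) => p pgx; apply: (subZ (sX _)).
by apply: filtW (leqnSn _) _; apply: IH => //; apply: br_LHc pgx.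
Qed.

(** On the base [z] acts as [psi z], so [cut z] vanishes there; each commutator with a letter on the
    way removes that letter. *)
Lemma filt_X_cut z d v : is_IJ z -> n%:Z <= idx z -> filt_X d.+1 v ->
  filt_X d (cut z v).
Proof.
move=> hz nz Fv; apply: (lspan_preim (f := cut z) (sX _) _ _ Fv).
  exact: linearP.
move=> _ [s [u [Xs sd Bu ->]]]; rewrite ltnS in sd; apply: filtW sd _.
elim: s Xs => [|x s IH] /=.
  move=> _; case: Bu => e Fu; rewrite /cut (filt_Y_scalar hz nz Fu) subrr.
  exact: lspan0.
move=> /andP[Xx Xs]; have /andP[hx _] := Xx.
have -> : cut z (rho x (word rho s u)) =
    rho x (cut z (word rho s u)) + brc z x *: rho (shift z (idx x)) (word rho s u).
  by rewrite /cut rhoB rhoZ rho_IJ_LH // addrAC.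
apply: (subD (sX _)); first by apply: filt_letter => //; apply: IH.
apply: (subZ (sX _)); apply: filt_X_IJ; first exact: shift_IJ.
by apply: filt_word.
Qed.

Definition dual_X (x : Gen) : {linear W -> W} :=
  let k := N - idx x in let q : Cx R := (k - idx x)%:~R in
  match x with
  | gL _ => dual_op (- (2 * q * a)^-1) (- (2 * q * b)^-1) (gI k) (gJ k)
  | _ => dual_op (- (2 * a)^-1) (2 * b)^-1 (gI k) (gJ k)
  end.

Lemma dual_X_lower d x v : letter_X x -> filt_X d.+1 v -> filt_X d (dual_X x v).
Proof.
move=> /andP[_ xm] Fv; case: x xm => [i|i|i|i|||] /= xm; apply: (subD (sX _));
  apply: (subZ (sX _)); apply: filt_X_cut => //=; lia.
Qed.

(** The commutators leave an [I] or [J] of index at least [N], which is [psi] plus a [cut]. The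
    [psi] parts give the Kronecker delta as for [dual_Y]; the [cut] parts lower the degree and form
    the error. *)
Lemma dual_X_der d x y v : letter_X x -> letter_X y -> idx x <= idx y ->
  filt_X d.+1 v ->
  filt_X d (dual_X x (rho y v) - rho y (dual_X x v) - (x == y)%:R *: v).
Proof.
move=> /andP[hx xm] /andP[hy ym] xy Fv.
have cutE z : is_IJ z -> cut z (rho y v) = rho y (cut z v) +
    brc z y *: cut (shift z (idx y)) v + (brc z y * psi (shift z (idx y))) *: v.
  move=> hz; rewrite /cut rhoB rhoZ rho_IJ_LH // scalerBr scalerA.
  by rewrite -[RHS]addrA subrK addrAC.
have coef al be (k := N - idx x) :
    al * (brc (gI k) y * psi (gI (idx y + k))) +
    be * (brc (gJ k) y * psi (gJ (idx y + k))) = (x == y)%:R ->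
    filt_X d (dual_op al be (gI k) (gJ k) (rho y v)
              - rho y (dual_op al be (gI k) (gJ k) v) - (x == y)%:R *: v).
  have abel (A B C D E F : W) :
      A + B + C + (D + E + F) - (A + D) - (C + F) = B + E.
    rewrite addrACA [A + B + _]addrACA.
    move: (A + D) (B + E) (C + F) => X Y Z.
    by rewrite (addrAC (X + Y + Z)) addrK (addrAC X) subrr add0r.
  move=> <-; set u := (X in filt_X d X).
  have -> : u = (al * brc (gI k) y) *: cut (gI (idx y + k)) v
              + (be * brc (gJ k) y) *: cut (gJ (idx y + k)) v.
    rewrite /u /dual_op !cutE // (rhoD y (al *: _)) !rhoZ /=.
    move: (cut _ v) (cut _ v) (rho y _) (rho y _) => P Q P' Q'.
    by rewrite !scalerDr !scalerA scalerDl abel.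
  by apply: (subD (sX _)); apply: (subZ (sX _)); apply: filt_X_cut => //=; lia.
have qE (i : int) : (N - i - i)%:~R != 0 :> Cx R.
  by rewrite intr_eq0; have := N_neq_double i; lia.
case: x hx xm xy cutE coef => // i _ im; case: y hy ym => // j _ jm ij _ coef;
  apply: coef; move: ij; rewrite /= le_eqVlt => /orP[/eqP <-|ij];
  rewrite ?(addrC i (N - i)) ?subrK ?eqxx /=.
all: try (have Nij : N < j + (N - i) by lia);
  try (rewrite ?(psiI0 Nij) ?(psiJ0 Nij) !mulr0 addr0;
    first [done | by case: eqP => // -[]; lia]).
all: have qN : (i - (N - i))%:~R = - (N - i - i)%:~R :> Cx R
    by rewrite -rmorphN; congr (_%:~R); lia.
all: rewrite ?qN; move: (qE i); move: (N - i - i)%:~R => q q0.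
all: by field; rewrite ?a_neq0 ?b_neq0 ?q0.
Qed.

Hypothesis generated : forall S, submodule rho S -> S w -> forall v, S v.

(** The union of the filtration contains [w] and is stable under every generator. *)
Lemma filt_X_all v : exists d, filt_X d v.
Proof.
apply: (generated (S := fun v => exists d, filt_X d v)) v; last first.
  exists 1%N; apply: (@filt_word _ _ _ _ _ _ 1 [::]) => //.
  by exists 1%N; apply: (@filt_word _ _ _ _ _ _ 1 [::]).
split=> [|c u v [d Fu] [e Fv]|g v [d Fv]].
- by exists 0%N; apply: sub0 (sX _).
- exists (maxn d e); apply: (sX _).2.
    exact: filtW (leq_maxl _ _) Fu.
  exact: filtW (leq_maxr _ _) Fv.
exists d.+1; have [hg|hg] := boolP (is_IJ g); last exact: filt_X_LHc.
by apply: filtW (leqnSn _) _; apply: filt_X_IJ.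
Qed.

(** Two stages: the derivatives in [L], [H] reduce to vectors of [base_X], which [filt_Y_trivial]
    then handles. *)
Lemma proper_submodule_zero U : submodule rho U -> ~ U w -> forall v, U v -> v = 0.
Proof.
move=> sU notUw v Uv; have [d Fv] := filt_X_all v.
move: d v Uv Fv; apply: (filt_trivial (A := dual_X) (idx := idx)).
- move=> d x y v /andP[hx _] /andP[hy _] Fv.
  rewrite rhoP; apply: (sub_sum (sX _)) => p pxy; apply: (subZ (sX _)).
  by apply: filt_X_LHc => //; apply: br_LHc pxy; [case: x hx|case: y hy].
- exact: dual_X_lower.
- exact: dual_X_der.
- by case=> // i v _ Uv; apply: dual_op_sub.
move=> v Uv Fv; have [e Fe] : exists e, filt_Y e v.
  elim: Fv {Uv} => [|c u t [s [b' [_ ss [d Fb] uE]]] _ [e Ft]].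
    by exists 0%N; apply: lspan0.
  exists (maxn d e); apply: (filt_subspace _ _ _ _).2.
    by case: s ss uE => // _ ->; apply: filtW (leq_maxl _ _) Fb.
  exact: filtW (leq_maxr _ _) Ft.
exact: (filt_Y_trivial sU notUw Uv Fe).
Qed.

Lemma generated_irreducible : w != 0 -> irreducible rho.
Proof.
move=> w0; split=> [|U sU]; first by exists w.
have [Uw|notUw] := pselect (U w); first by right; apply: generated.
by left; apply: proper_submodule_zero.
Qed.

End Irreducible.

Theorem theorem3p9 (R : realType) (m n : nat) (psi : Gen -> Cx R)
  (W : lmodType (Cx R)) (rho : Gen -> {linear W -> W}) (w : W) :
  (0 < m)%N -> odd m = odd n ->
  whittaker_fun m n psi ->
  induced_whittaker m n psi rho w ->
  (irreducible rho <->
   psi (gI (m + n - 1)%N%:Z) * psi (gJ (m + n - 1)%N%:Z) != 0).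
Proof.
move=> m_gt0 odd_mn psiP hW; have [rhoP wP _] := hW; split=> [irr|].
  by apply/eqP => ab0; apply: (not_irreducible m_gt0 psiP hW ab0 irr).
rewrite mulf_eq0 negb_or => /andP[a0 b0].
apply: (generated_irreducible m_gt0 odd_mn psiP rhoP wP a0 b0).
  by move=> S sS Sw v; apply: (induced_generated sS hW Sw v).
exact: (whittaker_vec_neq0 m_gt0 psiP hW).
Qed.
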